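(* Let $V$ be a set and let $\mathcal{B}\subseteq V^3$ be a ternary relation on $V$ (write $abc$ for $(a,b,c)$) satisfying: (B) for all pairwise distinct $a,b,c\in V$, $\mathcal{B}$ contains at least one of $abc,acb,bac,bca,cab,cba$; (C) for all $a,b,c\in V$, $abc\in\mathcal{B}$ implies $acb\notin\mathcal{B}$; (D) for all $a,b,c\in V$, $abc\in\mathcal{B}$ implies $a,b,c$ are pairwise distinct; (F) for all $a,b,c\in V$, $abc\in\mathcal{B}$ implies $bca\in\mathcal{B}$ or $cba\in\mathcal{B}$; (9) for all $a,b,c,x\in V$, $abc\in\mathcal{B}$ implies $abx\in\mathcal{B}$ or $xbc\in\mathcal{B}$. Then $\mathcal{B}$ satisfies axiom (A): for all $a,b,c\in V$, $abc\in\mathcal{B}$ implies $cba\in\mathcal{B}$; or $\mathcal{B}$ satisfies axiom (E): for all $a,b,c\in V$, $abc\in\mathcal{B}$ implies $bca\in\mathcal{B}$.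
   Context: A ternary relation on a set $V$ is a subset $\mathcal{B}\subseteq V\times V\times V$; the triple $(a,b,c)$ is written $abc$. *)

(* Defs.v *)
(* Plain Rocq (Stdlib style, no library needed): a ternary relation on the set
   [V] is a subset of V x V x V, given as a predicate. *)

Definition ternary (V : Type) : Type := V -> V -> V -> Prop.

Definition axiomA (V : Type) (B : ternary V) : Prop :=
  forall a b c : V, B a b c -> B c b a.

Definition axiomB (V : Type) (B : ternary V) : Prop :=
  forall a b c : V, a <> b -> a <> c -> b <> c ->
    B a b c \/ B a c b \/ B b a c \/ B b c a \/ B c a b \/ B c b a.

Definition axiomC (V : Type) (B : ternary V) : Prop :=
  forall a b c : V, B a b c -> ~ B a c b.

Definition axiomD (V : Type) (B : ternary V) : Prop :=
  forall a b c : V, B a b c -> a <> b /\ a <> c /\ b <> c.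

Definition axiomE (V : Type) (B : ternary V) : Prop :=
  forall a b c : V, B a b c -> B b c a.

Definition axiomF (V : Type) (B : ternary V) : Prop :=
  forall a b c : V, B a b c -> B b c a \/ B c b a.

(* Here [x] ranges over all of [V].  The instance x = b asks for [B a b b] or
   [B b b c], which axiom D forbids, so D and this axiom together force [B] to
   be empty. *)
Definition axiom9 (V : Type) (B : ternary V) : Prop :=
  forall a b c x : V, B a b c -> B a b x \/ B x b c.

(* Huntington's convention, under which the axiom holds for the betweenness of
   linear orders and for cyclic orders: [x] is a further element.  Only x <> b
   is a genuine restriction, the conclusion being trivial for x = a and x = c. *)
Definition axiom9_distinct (V : Type) (B : ternary V) : Prop :=
  forall a b c x : V, x <> a -> x <> b -> x <> c ->
    B a b c -> B a b x \/ B x b c.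

(* Main.v *)
Require Import Defs.
From Stdlib Require Import Classical.

(** By C, D and F the relation restricted to a three-element set is either a
    betweenness (one triple and its reverse) or a cyclic order (the three
    rotations of one triple).  Axiom (9) forbids a cyclic three-element set and
    a betweenness one to share two elements, so being cyclic is preserved by
    exchanging one element; exchanging three times, one cyclic three-element
    set makes all of them cyclic. *)

Section MixedTriples.

Context (V : Type) (B : ternary V).
Context (HB : axiomB V B) (HC : axiomC V B) (HD : axiomD V B) (HF : axiomF V B).
Context (H9 : axiom9_distinct V B).

(** Two rotations are enough to record: F and C force the third, as [cyc_rot] shows. *)
Definition cyc (a b c : V) : Prop := B a b c /\ B b c a.

(** Forgetting the orientation makes this a property of the unordered set, which is all that an
    exchange of one element controls. *)
Definition ucyc (a b c : V) : Prop := cyc a b c \/ cyc c b a.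

Lemma not_swap12 a b c : B a b c -> ~ B b a c.
Proof.
intros h k.
destruct (HF _ _ _ h) as [h1 | h1]; [exact (HC _ _ _ k h1) |].
destruct (HF _ _ _ k) as [k1 | k1]; [exact (HC _ _ _ h k1) |].
exact (HC _ _ _ h1 k1).
Qed.

Lemma cyc_rot a b c : cyc a b c -> cyc b c a.
Proof.
intros [h k]; split; [exact k |].
destruct (HF _ _ _ k) as [k1 | k1]; [exact k1 |].
destruct (HC _ _ _ h k1).
Qed.

Lemma ucyc_rot a b c : ucyc a b c -> ucyc b c a.
Proof.
intros [h | h]; [left; exact (cyc_rot _ _ _ h) |].
right; exact (cyc_rot _ _ _ (cyc_rot _ _ _ h)).
Qed.

Lemma ucyc_rev a b c : ucyc a b c -> ucyc c b a.
Proof. unfold ucyc; tauto. Qed.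

Lemma cyc_or_rev a b c : B a b c -> cyc a b c \/ B c b a.
Proof. intros h; unfold cyc; destruct (HF _ _ _ h); auto. Qed.

(** This and the next two lemmas exclude the three betweennesses on {x, b, c}; the suffix names the
    middle element. Each time (9) first forces both [B a b x] and [B x c a]. *)
Lemma betweenness_not_b x a b c :
  cyc a b c -> x <> a -> x <> b -> x <> c -> B x b c -> B c b x -> False.
Proof.
intros habc xa xb xc h k.
destruct habc as [abc bca].
destruct (HD _ _ _ abc) as (ab & ac & bc).
assert (abx : B a b x).
{ destruct (H9 _ _ _ a ac ab (not_eq_sym xa) k) as [cba |]; auto.
  destruct (not_swap12 _ _ _ bca cba). }
assert (xca : B x c a).
{ destruct (H9 _ _ _ x xb xc xa bca) as [bcx |]; auto.
  destruct (not_swap12 _ _ _ k bcx). }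
(* Whether {x, c, a} is cyclic or a betweenness, inserting [b] by (9) leaves two alternatives,
   refuted by C and by [not_swap12]. *)
destruct (cyc_or_rev _ _ _ xca) as [xca' | acx].
- destruct (cyc_rot _ _ _ xca') as [_ axc].
  destruct (H9 _ _ _ b (not_eq_sym ab) (not_eq_sym xb) bc axc) as [axb | bxc].
  + exact (HC _ _ _ abx axb).
  + exact (not_swap12 _ _ _ h bxc).
- destruct (H9 _ _ _ b (not_eq_sym ab) bc (not_eq_sym xb) acx) as [acb | bcx].
  + exact (HC _ _ _ abc acb).
  + exact (not_swap12 _ _ _ k bcx).
Qed.

Lemma betweenness_not_c x a b c :
  cyc a b c -> x <> a -> x <> b -> x <> c -> B x c b -> B b c x -> False.
Proof.
intros habc xa xb xc h k.
destruct habc as [abc bca].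
destruct (HD _ _ _ abc) as (ab & ac & bc).
assert (abx : B a b x).
{ destruct (H9 _ _ _ x xa xb xc abc) as [| xbc]; auto.
  destruct (HC _ _ _ h xbc). }
assert (xca : B x c a).
{ destruct (H9 _ _ _ a (not_eq_sym xa) ac ab h) as [| acb]; auto.
  destruct (HC _ _ _ abc acb). }
(* Now {a, b, x} is split instead, and [c] is inserted. *)
destruct (cyc_or_rev _ _ _ abx) as [[_ bxa] | xba].
- destruct (H9 _ _ _ c (not_eq_sym bc) (not_eq_sym xc) (not_eq_sym ac) bxa)
    as [bxc | cxa].
  + exact (HC _ _ _ k bxc).
  + exact (not_swap12 _ _ _ xca cxa).
- destruct (H9 _ _ _ c (not_eq_sym xc) (not_eq_sym bc) (not_eq_sym ac) xba)
    as [xbc | cba].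
  + exact (HC _ _ _ h xbc).
  + exact (not_swap12 _ _ _ bca cba).
Qed.

Lemma betweenness_not_x x a b c :
  cyc a b c -> x <> a -> x <> b -> x <> c -> B b x c -> B c x b -> False.
Proof.
intros [abc bca] xa xb xc h k.
destruct (HD _ _ _ abc) as (ab & ac & bc).
destruct (H9 _ _ _ x xa xb xc abc) as [abx | xbc];
  [| exact (not_swap12 _ _ _ h xbc)].
destruct (H9 _ _ _ x xb xc xa bca) as [bcx | xca]; [exact (HC _ _ _ h bcx) |].
destruct (H9 _ _ _ a ac (not_eq_sym xa) ab k) as [cxa | axb].
- exact (not_swap12 _ _ _ xca cxa).
- exact (HC _ _ _ abx axb).
Qed.

Lemma cyc_exchange x a b c :
  cyc a b c -> x <> b -> x <> c -> ucyc x b c.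
Proof.
intros h xb xc.
destruct (classic (x = a)) as [-> | xa]; [left; exact h |].
destruct (HD _ _ _ (proj1 h)) as (_ & _ & bc).
pose proof (betweenness_not_b x a b c h xa xb xc) as nb.
pose proof (betweenness_not_c x a b c h xa xb xc) as nc.
pose proof (betweenness_not_x x a b c h xa xb xc) as nx.
(* B supplies some triple on {x, b, c}; with every betweenness excluded, F leaves only a cyclic
   order, of unknown orientation. *)
destruct (HB x b c xb xc bc) as [t | [t | [t | [t | [t | t]]]]];
  destruct (cyc_or_rev _ _ _ t) as [u | u]; try tauto;
  pose proof (cyc_rot _ _ _ u); pose proof (cyc_rot _ _ _ (cyc_rot _ _ _ u));
  unfold ucyc; tauto.
Qed.

Lemma ucyc_exchange x a b c :
  ucyc a b c -> x <> b -> x <> c -> ucyc x b c.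
Proof.
intros [h | h] xb xc; [exact (cyc_exchange _ _ _ _ h xb xc) |].
apply ucyc_rev, ucyc_rot, (cyc_exchange x a); auto.
exact (cyc_rot _ _ _ (cyc_rot _ _ _ h)).
Qed.

Lemma ucyc_with_one a b c d : ucyc a b c -> exists p q, ucyc d p q.
Proof.
intros h.
destruct (classic (d = b)) as [-> | db]; [exists c, a; exact (ucyc_rot _ _ _ h) |].
destruct (classic (d = c)) as [-> | dc]; [exists b, a; exact (ucyc_rev _ _ _ h) |].
exists b, c; exact (ucyc_exchange _ _ _ _ h db dc).
Qed.

Lemma ucyc_with_two d p q e : ucyc d p q -> e <> d -> exists r, ucyc d e r.
Proof.
intros h ed.
destruct (classic (e = q)) as [-> | eq].
- exists p; apply ucyc_rev, ucyc_rot; exact h.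
(* Here [e] replaces [p], while [d] and [q] stay. *)
- exists q; apply ucyc_rot, ucyc_rot, (ucyc_exchange e p); auto.
  apply ucyc_rot; exact h.
Qed.

Lemma cyclic_everywhere a b c : cyc a b c -> axiomE V B.
Proof.
intros h d e f def.
destruct (HD _ _ _ def) as (de & df & ef).
destruct (ucyc_with_one a b c d (or_introl h)) as (p & q & h1).
destruct (ucyc_with_two d p q e h1 (not_eq_sym de)) as (r & h2).
assert (h3 : ucyc f d e).
{ apply (ucyc_exchange f r); auto; apply ucyc_rot, ucyc_rot; exact h2. }
(* The given triple [def] selects the orientation. *)
destruct (ucyc_rot _ _ _ h3) as [[_ efd] | [_ edf]]; [exact efd |].
destruct (not_swap12 _ _ _ def edf).
Qed.

Lemma axiomA_or_axiomE : axiomA V B \/ axiomE V B.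
Proof.
destruct (classic (exists a b c, cyc a b c)) as [(a & b & c & h) | none].
- right; exact (cyclic_everywhere a b c h).
- left; intros a b c abc.
  destruct (cyc_or_rev _ _ _ abc) as [h | h]; [| exact h].
  destruct none; exists a, b, c; exact h.
Qed.

End MixedTriples.

Theorem theorem1 (V : Type) (B : ternary V) :
  axiomB V B -> axiomC V B -> axiomD V B -> axiomF V B ->
  (axiom9 V B -> axiomA V B \/ axiomE V B) /\
  (axiom9_distinct V B -> axiomA V B \/ axiomE V B).
Proof.
intros HB HC HD HF; split; intros H9; apply axiomA_or_axiomE; auto.
(* The unrestricted form of (9) implies the restricted one. *)
intros a b c x _ _ _; apply H9.
Qed.
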